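(* Let $\Omega_d=\bigoplus_{r\ge0}\Omega^r_d$ be the $\mathbb C$-vector space $\Omega$ of differential forms over $S=\mathbb C[x_1,\dots,x_n]$, with $\Omega^r_d=\Omega^r$, endowed with the action of $S$ given for $f\in S(c)$, $\tau\in\Omega^r(b)$ by $$f\cdot_d\tau=\frac{1}{b+c}\big(b\,f\tau+df\wedge i_R\tau\big)\quad\text{if } (b,c)\neq(0,0),\qquad f\cdot_d\tau=f\tau\quad\text{if } b=c=0 .$$ Then the exterior differential $d:\Omega_d\to\Omega_d$ is a morphism of $S$-modules, and the $S$-modules $\Omega^r_d$ are finitely generated.
   Context: $S=\mathbb C[x_1,\dots,x_n]$ and $\Omega=\bigoplus_{r\ge0}\Omega^r$ is the exterior algebra of (Kähler) differential forms of $S$ over $\mathbb C$. Each $\Omega^r$ is graded, $\Omega^r=\bigoplus_{b\ge0}\Omega^r(b)$, with each $x_i$ and each $dx_i$ of degree $1$; $S(c)$ is the space of homogeneous polynomials of degree $c$. $d$ is the exterior differential, $R=\sum_i x_i\frac{\partial}{\partial x_i}$ is the radial vector field, and $i_R$ is contraction with $R$ (zero on $\Omega^0$). The action is extended additively to non-homogeneous elements. *)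

(* Defs.v *)
From HB Require Import structures.
From mathcomp Require Import all_boot all_order all_algebra.
From mathcomp Require Import mpoly.

Set Implicit Arguments.
Unset Strict Implicit.
Unset Printing Implicit Defensive.

Import GRing.Theory.
Local Open Scope ring_scope.

(* Differential forms over S = K[x_1, ..., x_n]. The module of Kähler
   differentials of S is free on dx_1, ..., dx_n, so its exterior algebra is
   free on the dx_I = dx_{i_1} /\ ... /\ dx_{i_r}, for I = {i_1 < ... < i_r};
   w : form K n stands for \sum_I (w I) dx_I. *)
Notation form K n := {ffun {set 'I_n} -> {mpoly K[n]}}.

Section Forms.
Variables (K : fieldType) (n : nat).
Local Notation S := {mpoly K[n]}.
Local Notation Omega := (form K n).

(* dx_I /\ dx_J = (-1) ^+ (inversions I J) dx_(I :|: J) for disjoint I, J *)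
Definition inversions (I J : {set 'I_n}) : nat :=
  #|[set ij : 'I_n * 'I_n | [&& ij.1 \in I, ij.2 \in J & (ij.2 < ij.1)%N]]|.

Definition wedge (u v : Omega) : Omega :=
  [ffun L : {set 'I_n} => \sum_(I : {set 'I_n} | I \subset L)
     (-1) ^+ inversions I (L :\: I) * (u I * v (L :\: I))].

Definition form0 (f : S) : Omega := [ffun I => if I == set0 then f else 0].

Definition fmul (f : S) (w : Omega) : Omega := [ffun I => f * w I].

Definition dx (i : 'I_n) : Omega := [ffun I => (I == [set i])%:R].

Definition pderiv (i : 'I_n) (w : Omega) : Omega := [ffun I => (w I)^`M(i)].

Definition extd (w : Omega) : Omega := \sum_(i < n) wedge (dx i) (pderiv i w).

(* contraction with the vector field \sum_i (v i) d/dx_i: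
   i_v dx_I = \sum_(i in I) (-1) ^+ #|{j in I | j < i}| (v i) dx_(I :\ i) *)
Definition contract (v : 'I_n -> S) (w : Omega) : Omega :=
  [ffun J : {set 'I_n} => \sum_(i | i \notin J)
     (-1) ^+ inversions [set i] J * (v i * w (i |: J))].

Definition radial (i : 'I_n) : S := 'X_i.

(* the subspace Omega^r *)
Definition rform (r : nat) (w : Omega) : Prop :=
  forall I : {set 'I_n}, #|I| != r -> w I = 0.

(* The component of degree b, where the x_i and the dx_i have degree 1; it is
   the projection onto the direct sum of the Omega^r(b) over all r. *)
Definition fcomp (b : nat) (w : Omega) : Omega :=
  [ffun I : {set 'I_n} =>
     if (#|I| <= b)%N then pihomog mdeg (b - #|I|) (w I) else 0].

Definition fhomog (b : nat) (w : Omega) : Prop := fcomp b w = w.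

(* strict upper bound on the degrees of the components of w, as msize is for
   the degrees of the monomials of a polynomial *)
Definition fsize (w : Omega) : nat :=
  \max_(I : {set 'I_n}) (#|I| + msize (w I))%N.

(* f ._d t for f homogeneous of degree c and t homogeneous of degree b *)
Definition dact_homog (c b : nat) (f : S) (t : Omega) : Omega :=
  if (b == 0)%N && (c == 0)%N then fmul f t
  else ((b + c)%:R^-1 : K) *:
         ((b%:R : K) *: fmul f t
          + wedge (extd (form0 f)) (contract radial t)).

Definition dact (f : S) (t : Omega) : Omega :=
  \sum_(c < msize f) \sum_(b < fsize t)
     dact_homog c b (pihomog mdeg c f) (fcomp b t).

End Forms.

(* The notions of module below are relative to an arbitrary candidate action on
   an abelian group, since V is not meant to carry act as its canonical
   scaling. *)
Section Modules.
Variable (A : nzRingType).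

Definition is_module (V : zmodType) (act : A -> V -> V) : Prop :=
  [/\ forall a b v, act a (act b v) = act (a * b) v,
      forall v, act 1 v = v,
      forall a u v, act a (u + v) = act a u + act a v
    & forall a b v, act (a + b) v = act a v + act b v].

Definition is_module_morphism (V W : zmodType) (actV : A -> V -> V)
    (actW : A -> W -> W) (phi : V -> W) : Prop :=
  (forall u v, phi (u + v) = phi u + phi v) /\
  (forall a v, phi (actV a v) = actW a (phi v)).

Definition is_submodule (V : zmodType) (act : A -> V -> V)
    (P : V -> Prop) : Prop :=
  [/\ P 0, forall u v, P u -> P v -> P (u + v)
    & forall a v, P v -> P (act a v)].

Definition fin_generated (V : zmodType) (act : A -> V -> V)
    (P : V -> Prop) : Prop :=
  exists (m : nat) (g : 'I_m -> V),
    (forall j, P (g j)) /\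
    (forall v, P v -> exists a : 'I_m -> A, v = \sum_(j < m) act (a j) (g j)).

End Modules.

Section HomogeneousAction.
Variables (K : fieldType) (n : nat).

Lemma dact_homog0 c b (f : {mpoly K[n]}) : dact_homog c b f 0 = 0.
Proof.
have f0 : fmul f 0 = 0 by apply/ffunP=> I; rewrite !ffunE mulr0.
have c0 : contract (@radial K n) 0 = 0.
  by apply/ffunP=> I; rewrite !ffunE big1 // => i _; rewrite ffunE !mulr0.
have w0 (u : form K n) : wedge u 0 = 0.
  by apply/ffunP=> I; rewrite !ffunE big1 // => J _; rewrite ffunE !mulr0.
by rewrite /dact_homog f0 c0 w0 scaler0 addr0 scaler0 if_same.
Qed.

Lemma dact0 (t : form K n) : dact 0 t = 0.
Proof. by rewrite /dact msize0 big_ord0. Qed.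

Lemma dact_homog0l c b (t : form K n) : dact_homog c b 0 t = 0.
Proof.
have f0 : fmul 0 t = 0 by apply/ffunP=> I; rewrite !ffunE mul0r.
have p0 (i : 'I_n) : pderiv i (@form0 K n 0) = 0.
  by apply/ffunP=> I; rewrite !ffunE if_same mderiv0.
have w0 (u : form K n) : wedge u 0 = 0.
  by apply/ffunP=> I; rewrite !ffunE big1 // => J _; rewrite ffunE !mulr0.
have w0l (u : form K n) : wedge 0 u = 0.
  by apply/ffunP=> I; rewrite !ffunE big1 // => J _; rewrite ffunE mul0r mulr0.
have d0 : extd (@form0 K n 0) = 0.
  by rewrite /extd big1 // => i _; rewrite p0 w0.
by rewrite /dact_homog f0 d0 w0l scaler0 addr0 scaler0 if_same.
Qed.

(* On homogeneous arguments the action is given by the defining formula. *)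
Lemma dactE c b (f : {mpoly K[n]}) (t : form K n) :
  f \is c.-homog -> fhomog b t -> dact f t = dact_homog c b f t.
Proof.
move=> hf ht; have [->|f_neq0] := eqVneq f 0; first by rewrite dact0 dact_homog0l.
have [->|t_neq0] := eqVneq t 0.
  rewrite dact_homog0 /dact big1 // => i _; rewrite big1 // => j _.
  suff -> : fcomp j (0 : form K n) = 0 by rewrite dact_homog0.
  by apply/ffunP=> I; rewrite !ffunE pihomog0 if_same.
have htI (I : {set 'I_n}) : t I != 0 -> (#|I| <= b)%N /\ t I \is (b - #|I|).-homog.
  move=> tI; move: (ffunE (fun I : {set 'I_n} =>
     if (#|I| <= b)%N then pihomog mdeg (b - #|I|) (t I) else 0) I).
  rewrite -/(fcomp b t) ht; case: ifP => [_ e|_ e]; last by rewrite e eqxx in tI.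
  by split=> //; rewrite e pihomogP.
have comp0 d : d != b -> fcomp d t = 0.
  move=> db; apply/ffunP=> I; rewrite !ffunE; case: ifP => // Id.
  have [->|/htI[Ib hI]] := eqVneq (t I) 0; first by rewrite pihomog0.
  by apply: pihomog_ne0 hI; rewrite -(eqn_add2r #|I|) !subnK // eq_sym.
have msz d (p : {mpoly K[n]}) : p \is d.-homog -> p != 0 -> msize p = d.+1.
  move=> hp p_neq0; rewrite (dhomog_uniq p_neq0 hp (dhomog_msize hp)).
  by rewrite prednK // lt0n mmeasure_poly_eq0.
have cf : (c < msize f)%N by rewrite (msz _ _ hf).
have bt : (b < fsize t)%N.
  have [I tI] : exists I, t I != 0.
    apply/existsP; apply: contraR t_neq0; rewrite negb_exists => /forallP h.
    by apply/eqP/ffunP=> I; rewrite ffunE; apply/eqP; rewrite -[_ == _]negbK.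
  apply: leq_trans (leq_bigmax I); have [Ib hI] := htI I tI.
  by rewrite (msz _ _ hI tI) addnS ltnS subnKC.
rewrite /dact (bigD1 (Ordinal cf)) //= [X in _ + X]big1 ?addr0; last first.
  move=> i ic; rewrite big1 // => j _.
  by rewrite (pihomog_ne0 _ hf) ?dact_homog0l // eq_sym.
rewrite (bigD1 (Ordinal bt)) //= [X in _ + X]big1 ?addr0; last first.
  by move=> j jb; rewrite comp0 ?dact_homog0.
by rewrite pihomog_dE // ht.
Qed.

End HomogeneousAction.

(* Main.v *)
Require Import Defs.
From HB Require Import structures.
From mathcomp Require Import all_boot all_order all_algebra.
From mathcomp Require Import mpoly complex reals ring.

Set Implicit Arguments.
Unset Strict Implicit.
Unset Printing Implicit Defensive.

Import GRing.Theory.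
Local Open Scope ring_scope.

(* Let L = d i_R + i_R d; by Cartan's formula L multiplies a form of degree b by
   b. Let G invert L in positive degrees and vanish in degree 0, and let P be
   the projection onto degree 0. Since b f t = f L t and d (f i_R t) =
   df /\ i_R t + f d i_R t, the action extended to all forms is
     f . t = G (d (f i_R t) + f i_R (d t)) + P (f t).
   From d d = 0, i_R i_R = 0 and the fact that G commutes with d and i_R one
   reads off i_R (f . t) = f i_R t and d (f . t) = f . d t, hence the module
   axioms and the linearity of d. For finite generation write
   w = G d i_R w + P w + G i_R d w and expand w and dw in the basis dx_I: on a
   closed form e one has f . e = G d i_R (f e) + P (f e) and
   f . i_R e = G i_R (f L e), so the dx_I with #|I| = r and the i_R dx_J with
   #|J| = r + 1 generate the forms of degree r. *)

(** * Actions built from a homotopy [d i + i d = L], in an abstract setting *)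

Section HomotopyAction.
Variables (A : nzRingType) (V : zmodType).
Variables (mul : A -> {additive V -> V}) (d i L G P : {additive V -> V}).
Implicit Types (f g : A) (t u v w : V).

Definition homotopy_act f t : V :=
  G (d (mul f (i t)) + mul f (i (d t))) + P (mul f t).
Local Notation act := homotopy_act.

Lemma homotopy_act0 f : act f 0 = 0.
Proof. by rewrite /act !raddf0 !addr0 raddf0. Qed.

Hypothesis mulA : forall f g v, mul f (mul g v) = mul (f * g) v.
Hypothesis mul1 : forall v, mul 1 v = v.
Hypothesis mulDl : forall f g v, mul (f + g) v = mul f v + mul g v.
Hypothesis dd : forall v, d (d v) = 0.
Hypothesis ii : forall v, i (i v) = 0.
Hypothesis homotopy : forall v, d (i v) + i (d v) = L v.
Hypothesis i_mul : forall f v, i (mul f v) = mul f (i v).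
Hypothesis dG : forall v, d (G v) = G (d v).
Hypothesis iG : forall v, i (G v) = G (i v).
Hypothesis dP : forall v, d (P v) = 0.
Hypothesis iP : forall v, i (P v) = 0.
Hypothesis Pi : forall v, P (i v) = 0.
Hypothesis Pd : forall v, P (d v) = 0.
Hypothesis PG : forall v, P (G v) = 0.
Hypothesis PP : forall v, P (P v) = P v.
Hypothesis GL : forall v, G (L v) = v - P v.
Hypothesis P_mulP : forall f v, P (mul f (P v)) = P (mul f v).

(** As [i i = 0], only [i (d (f (i t)))] survives, and on the kernel of [i] the operator [i d] is
    [L]. Then [G L = 1 - P], and [P] kills [f (i t) = i (f t)]. *)
Lemma contract_homotopy_act f t : i (act f t) = mul f (i t).
Proof.
have e : i (d (mul f (i t))) = L (mul f (i t)).
  by rewrite -homotopy i_mul ii !raddf0 add0r.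
rewrite /act raddfD /= iP addr0 iG raddfD /= e i_mul ii raddf0 addr0.
by rewrite GL -i_mul Pi subr0.
Qed.

(** Both sides reduce to [G (d (f (i (d t))))]: the remaining homotopy terms contain [d d], and
    [P (f (d t)) = P (f (P (d t))) = 0]. *)
Lemma diff_homotopy_act f t : d (act f t) = act f (d t).
Proof.
rewrite /act raddfD /= dP addr0 dG raddfD /= !dd !raddf0 add0r addr0.
rewrite -[LHS]addr0; congr (_ + _); rewrite -P_mulP Pd.
by rewrite !raddf0.
Qed.

Lemma homotopy_act_module : is_module act.
Proof.
have Pact f t : P (act f t) = P (mul f t) by rewrite /act raddfD /= PG add0r PP.
split=> [f g t|t|f u v|f g v].
(* The value of [act f u] depends on [u] only through [i u], [i (d u)] and [P u]; for [u = act g t]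
   these are [g (i t)], [g (i (d t))] and [P (g t)]. *)
- rewrite {1}/act contract_homotopy_act diff_homotopy_act contract_homotopy_act.
  rewrite -P_mulP Pact P_mulP.
  by rewrite !mulA.
- by rewrite /act !mul1 homotopy GL subrK.
- by rewrite /act !raddfD /= (addrACA (G (d _))) [LHS]addrACA.
- by rewrite /act !mulDl !raddfD /= (addrACA (G (d _))) [LHS]addrACA.
Qed.

Lemma homotopy_act_closed f v : d v = 0 ->
  act f v = G (d (i (mul f v))) + P (mul f v).
Proof. by move=> dv; rewrite /act dv !raddf0 addr0 i_mul. Qed.

Lemma homotopy_act_contract_closed f v : d v = 0 ->
  act f (i v) = G (i (mul f (L v))).
Proof.
move=> dv; rewrite /act ii raddf0 raddf0 add0r -[mul f (i v)]i_mul Pi addr0.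
by rewrite -homotopy dv raddf0 addr0 i_mul.
Qed.

Lemma homotopy_decomp v : v = G (d (i v)) + P v + G (i (d v)).
Proof. by rewrite addrAC -raddfD homotopy GL subrK. Qed.

End HomotopyAction.

(** * Signs and Clifford relations in the exterior algebra *)

Section ExteriorCalculus.
Variables (K : fieldType) (n : nat).
Local Notation S := {mpoly K[n]}.
Local Notation Omega := {ffun {set 'I_n} -> {mpoly K[n]}}.
Implicit Types (i j : 'I_n) (I J L : {set 'I_n}) (f g : S) (u v w : Omega).

Lemma formDE u v I : (u + v) I = u I + v I. Proof. exact: ffunE. Qed.
Lemma formNE u I : (- u) I = - u I. Proof. exact: ffunE. Qed.
Lemma formZE (a : K) u I : (a *: u) I = a *: u I. Proof. exact: ffunE. Qed.
Definition formE := (formDE, formNE, formZE).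

Definition sgn1 i J : S := (-1) ^+ inversions [set i] J.

Lemma inversions1 i J : inversions [set i] J = (\sum_(j in J) (j < i))%N.
Proof.
rewrite /inversions -sum1dep_card (eq_bigl (fun p => (p.1 \in [set i]) &&
  ((p.2 \in J) && (p.2 < i)%N))); last first.
  by move=> [a b]; rewrite /= inE; case: eqP => //= ->.
rewrite -(pair_big_dep (fun a => a \in [set i])
  (fun a b => (b \in J) && (b < i)%N) (fun _ _ => 1%N)) /= big_set1.
by rewrite big_mkcondr.
Qed.

Lemma sgn1U1 i j J : j \notin J ->
  sgn1 i (j |: J) = (-1) ^+ (j < i)%N * sgn1 i J.
Proof. by move=> jJ; rewrite /sgn1 !inversions1 big_setU1 //= exprD. Qed.

Lemma sgn1K i J f : sgn1 i J * (sgn1 i J * f) = f.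
Proof. by rewrite mulrA -expr2 sqrr_sign mul1r. Qed.

(** Inserting an index changes only the sign of a larger one, so exactly one of the two orders picks
    up an extra factor -1. Both anticommutation rules below rest on this. *)
Lemma sgn1_swap i j J f : i != j -> i \notin J -> j \notin J ->
  sgn1 i (j |: J) * (sgn1 j J * f) = - (sgn1 j (i |: J) * (sgn1 i J * f)).
Proof.
move=> ij iJ jJ; rewrite !sgn1U1 //.
have [ltij|ltji|/val_inj eij] := ltngtP i j.
- by rewrite expr0 expr1; ring.
- by rewrite expr0 expr1; ring.
- by rewrite eij eqxx in ij.
Qed.

Lemma wedge_dxE i w L :
  wedge (dx K i) w L = if i \in L then sgn1 i (L :\ i) * w (L :\ i) else 0.
Proof.
rewrite ffunE; case: ifP => iL.
  rewrite (bigD1 [set i]) ?sub1set //= !ffunE eqxx mul1r big1 ?addr0 // => I.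
  by case/andP=> _ /negPf Ii; rewrite !ffunE Ii mul0r mulr0.
rewrite big1 // => I sIL; rewrite ffunE.
have [eI|_] := eqVneq; last by rewrite mul0r mulr0.
by rewrite eI sub1set iL in sIL.
Qed.

(** Contraction with the coordinate field [d/dx_i]. *)
Definition contract1 i w : Omega :=
  [ffun J : {set 'I_n} => if i \in J then 0 else sgn1 i J * w (i |: J)].

Lemma contract1E i w J :
  contract1 i w J = if i \in J then 0 else sgn1 i J * w (i |: J).
Proof. by rewrite ffunE. Qed.

Local Notation ext i := (wedge (dx K i)).

Lemma ext_anticomm i j w : ext i (ext j w) = - ext j (ext i w).
Proof.
apply/ffunP=> L; rewrite [RHS]formNE [LHS]wedge_dxE.
rewrite [X in _ = - X]wedge_dxE !wedge_dxE !in_setD1.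
have [->|neq_ij] := eqVneq i j; first by rewrite /= mulr0 if_same oppr0.
rewrite /=; case: ifP => iL; case: ifP => jL; rewrite ?mulr0 ?oppr0 //.
set J := L :\ i :\ j.
have eLi : L :\ i = j |: J by rewrite setD1K // !inE eq_sym neq_ij.
have eJ : L :\ j :\ i = J by apply/setP=> k; rewrite !inE andbCA.
have eLj : L :\ j = i |: J by rewrite -eJ setD1K // !inE neq_ij.
rewrite eJ eLi eLj; apply: sgn1_swap => //; first by rewrite /J !inE eqxx andbF.
by rewrite /J !inE eqxx.
Qed.

Lemma contract1_anticomm i j w :
  contract1 i (contract1 j w) = - contract1 j (contract1 i w).
Proof.
apply/ffunP=> J; rewrite [RHS]formNE !contract1E !in_setU1.
have [->|neq_ij] := eqVneq i j; first by rewrite /= mulr0 if_same oppr0.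
rewrite /=; case: ifPn => iJ; case: ifPn => jJ; rewrite ?mulr0 ?oppr0 //.
by rewrite mulrCA sgn1_swap 1?eq_sym // setUCA mulrCA.
Qed.

(** The Clifford relation. For [i = j] exactly one summand is present at [L], according to whether
    [i \in L]; for [i != j] the two sign products are opposite, since one of [j < i] and [i < j]
    holds. *)
Lemma ext_contract1 i j w :
  ext i (contract1 j w) + contract1 j (ext i w) = (i == j)%:R *: w.
Proof.
apply/ffunP=> L.
rewrite [LHS]formDE [RHS]formZE wedge_dxE !contract1E wedge_dxE in_setD1 in_setU1.
have [<-|neq_ij] := eqVneq i j.
  rewrite /= scale1r; case: ifPn => iL.
    by rewrite setD1K // sgn1K addr0.
  by rewrite setU1K // sgn1K add0r.
rewrite /= scale0r; case: ifPn => iL; last first.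
  by rewrite mulr0 if_same addr0.
case: ifPn => jL; first by rewrite mulr0 addr0.
set J := L :\ i.
have eL : L = i |: J by rewrite setD1K.
have iJ : i \notin J by rewrite !inE eqxx.
have jJ : j \notin J by rewrite !inE (negPf jL) andbF.
have -> : (j |: L) :\ i = j |: J.
  by rewrite eL setUCA setU1K // !inE (negPf neq_ij) /= eqxx.
rewrite [in sgn1 j L]eL !sgn1U1 //.
have [ltij|ltji|/val_inj eij] := ltngtP i j; last by rewrite eij eqxx in neq_ij.
  by rewrite expr0 expr1; ring.
by rewrite expr0 expr1; ring.
Qed.

End ExteriorCalculus.

(** * Exterior differential, contraction and Cartan's formula *)

Section Operators.
Variables (K : fieldType) (n : nat).
Local Notation S := {mpoly K[n]}.
Local Notation Omega := {ffun {set 'I_n} -> {mpoly K[n]}}.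
Implicit Types (i j : 'I_n) (I J L : {set 'I_n}) (f g : S) (u v w : Omega).
Local Notation ext i := (wedge (dx K i)).
Local Notation iR := (contract (@radial K n)).

Lemma wedge_is_linear u : linear (wedge u).
Proof.
move=> a v w; apply/ffunP=> L; rewrite !ffunE scaler_sumr -big_split /=.
apply: eq_bigr => I _; rewrite !ffunE.
by rewrite mulrDr mulrDr !scalerAr.
Qed.
HB.instance Definition _ u := GRing.isLinear.Build K Omega Omega _ (wedge u)
  (wedge_is_linear u).

Lemma contract1_is_linear i : linear (@contract1 K n i).
Proof.
move=> a v w; apply/ffunP=> L; rewrite !ffunE.
by case: ifP => _; rewrite ?scaler0 ?addr0 // mulrDr scalerAr.
Qed.
HB.instance Definition _ i := GRing.isLinear.Build K Omega Omega _
  (contract1 i) (contract1_is_linear i).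

Lemma pderiv_is_linear i : linear (@pderiv K n i).
Proof. by move=> a v w; apply/ffunP=> L; rewrite !ffunE linearP. Qed.
HB.instance Definition _ i := GRing.isLinear.Build K Omega Omega _
  (pderiv i) (pderiv_is_linear i).

Lemma fmul_is_linear f : linear (fmul f : Omega -> Omega).
Proof.
by move=> a v w; apply/ffunP=> L; rewrite !ffunE mulrDr scalerAr.
Qed.
HB.instance Definition _ f := GRing.isLinear.Build K Omega Omega _ (fmul f)
  (fmul_is_linear f).

Lemma extd_is_linear : linear (@extd K n).
Proof.
move=> a v w; rewrite /extd scaler_sumr -big_split /=.
by apply: eq_bigr => i _; rewrite !linearP.
Qed.
HB.instance Definition _ := GRing.isLinear.Build K Omega Omega _ (@extd K n)
  extd_is_linear.

Lemma contractE (X : 'I_n -> S) w :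
  contract X w = \sum_i fmul (X i) (contract1 i w).
Proof.
apply/ffunP=> J; rewrite sum_ffunE ffunE [LHS]big_mkcond /=.
apply: eq_bigr => i _; rewrite !ffunE; case: (i \in J) => /=.
  by rewrite mulr0.
by rewrite mulrCA.
Qed.

Lemma contract_is_linear (X : 'I_n -> S) : linear (contract X).
Proof.
move=> a v w; rewrite !contractE scaler_sumr -big_split /=.
by apply: eq_bigr => i _; rewrite !linearP.
Qed.
HB.instance Definition _ X := GRing.isLinear.Build K Omega Omega _ (contract X)
  (contract_is_linear X).

Lemma fmulDl f g w : fmul (f + g) w = fmul f w + fmul g w.
Proof. by apply/ffunP=> I; rewrite !ffunE mulrDl. Qed.

Lemma fmulA f g w : fmul f (fmul g w) = fmul (f * g) w.
Proof. by apply/ffunP=> I; rewrite !ffunE mulrA. Qed.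

Lemma fmulCA f g w : fmul f (fmul g w) = fmul g (fmul f w).
Proof. by rewrite !fmulA mulrC. Qed.

Lemma fmul1 w : fmul 1 w = w.
Proof. by apply/ffunP=> I; rewrite !ffunE mul1r. Qed.

Lemma fmulZl (a : K) f w : fmul (a *: f) w = a *: fmul f w.
Proof. by apply/ffunP=> I; rewrite !ffunE scalerAl. Qed.

Lemma mderiv_sgn1 i j J f : (sgn1 K i J * f)^`M(j) = sgn1 K i J * f^`M(j).
Proof.
by rewrite /sgn1 -signr_odd !mulr_sign; case: odd; rewrite ?mderivN.
Qed.

Lemma pderiv_ext i j w : pderiv i (ext j w) = ext j (pderiv i w).
Proof.
apply/ffunP=> L; rewrite [LHS]ffunE !wedge_dxE.
case: ifP => _; last exact: mderiv0.
by rewrite mderiv_sgn1 [in RHS]ffunE.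
Qed.

Lemma pderiv_contract1 i j w :
  pderiv i (contract1 j w) = contract1 j (pderiv i w).
Proof.
apply/ffunP=> J; rewrite !ffunE; case: ifP => _; first exact: mderiv0.
exact: mderiv_sgn1.
Qed.

Lemma pderiv_comm i j w : pderiv i (pderiv j w) = pderiv j (pderiv i w).
Proof. by apply/ffunP=> I; rewrite !ffunE mderiv_comm. Qed.

Lemma pderiv_fmul i f w :
  pderiv i (fmul f w) = fmul f^`M(i) w + fmul f (pderiv i w).
Proof. by apply/ffunP=> I; rewrite !ffunE mderivM. Qed.

Lemma ext_fmul i f w : ext i (fmul f w) = fmul f (ext i w).
Proof.
apply/ffunP=> L; rewrite [RHS]ffunE !wedge_dxE.
case: ifP => _; last by rewrite mulr0.
by rewrite ffunE mulrCA.
Qed.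

Lemma contract1_fmul i f w : contract1 i (fmul f w) = fmul f (contract1 i w).
Proof.
apply/ffunP=> J; rewrite !ffunE; case: ifP => _; first by rewrite mulr0.
by rewrite mulrCA.
Qed.

Lemma contract_fmul X f w : contract X (fmul f w) = fmul f (contract X w).
Proof.
rewrite !contractE linear_sum; apply: eq_bigr => i _.
by rewrite contract1_fmul fmulCA.
Qed.

Lemma extd_form0 f : extd (form0 f) = \sum_i fmul f^`M(i) (dx K i).
Proof.
apply: eq_bigr => i _; apply/ffunP=> L; rewrite wedge_dxE !ffunE.
have [->|neqL] := eqVneq L [set i].
  by rewrite inE eqxx setDv eqxx mulr1 /sgn1 inversions1 big_set0 mul1r.
case: ifP => iL; last by rewrite mulr0.
case: eqP => [/eqP|_]; last by rewrite mderiv0 !mulr0.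
by rewrite setD_eq0 subset1 (negPf neqL) => /eqP eL; rewrite eL inE in iL.
Qed.

Lemma wedge_sumfmul (a : 'I_n -> S) w :
  wedge (\sum_i fmul (a i) (dx K i)) w = \sum_i fmul (a i) (ext i w).
Proof.
apply/ffunP=> L; rewrite sum_ffunE ffunE.
rewrite (eq_bigr (fun I => \sum_i (-1) ^+ inversions I (L :\: I) *
  (a i * dx K i I * w (L :\: I)))); last first.
  move=> I _; rewrite sum_ffunE mulr_suml mulr_sumr.
  by apply: eq_bigr => i _; rewrite ffunE.
rewrite exchange_big /=; apply: eq_bigr => i _.
rewrite !ffunE mulr_sumr; apply: eq_bigr => I _.
by rewrite -mulrA mulrCA.
Qed.

(** Leibniz rule; it is what brings [df /\ i_R t] out of [d (f i_R t)]. *)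
Lemma extd_fmul f w :
  extd (fmul f w) = wedge (extd (form0 f)) w + fmul f (extd w).
Proof.
rewrite extd_form0 wedge_sumfmul linear_sum -big_split /=.
by apply: eq_bigr => i _; rewrite pderiv_fmul linearD /= !ext_fmul.
Qed.

Hypothesis K0 : [pchar K] =i pred0.

(** Exchanging the two indices shows that the sum equals its opposite, and 2 is invertible in
    characteristic zero. *)
Lemma sum_anticomm (F : 'I_n -> 'I_n -> Omega) :
  (forall i j, F i j = - F j i) -> \sum_i \sum_j F i j = 0.
Proof.
move=> antiF; set s := \sum_i _.
have sN : s = - s.
  rewrite {1}/s exchange_big /= -sumrN; apply: eq_bigr => i _.
  by rewrite -sumrN; apply: eq_bigr => j _.
have: (2%:R : K) *: s = 0 by rewrite scaler_nat mulr2n {1}sN addNr.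
move/eqP; rewrite scaler_eq0 => /orP[|/eqP //].
by rewrite ((pcharf0P K).1 K0).
Qed.

(** Exterior multiplications anticommute while partial derivatives commute. *)
Lemma extd_extd w : extd (extd w) = 0.
Proof.
rewrite {1}/extd (eq_bigr
  (fun i => \sum_j ext i (ext j (pderiv i (pderiv j w))))).
  by apply: sum_anticomm => i j; rewrite ext_anticomm pderiv_comm.
by move=> i _; rewrite !linear_sum; apply: eq_bigr => j _; rewrite /= pderiv_ext.
Qed.

Lemma contract_contract X w : contract X (contract X w) = 0.
Proof.
rewrite contractE (eq_bigr
  (fun i => \sum_j fmul (X i * X j) (contract1 i (contract1 j w)))).
  by apply: sum_anticomm => i j; rewrite contract1_anticomm linearN mulrC.
move=> i _; rewrite contractE !linear_sum; apply: eq_bigr => j _ /=.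
by rewrite contract1_fmul fmulA.
Qed.

(** The Lie derivative along the radial field in coordinates: the first term counts the factors
    [dx_i], the second is Euler's operator on the coefficients. *)
Definition euler w : Omega :=
  [ffun I : {set 'I_n} => #|I|%:R *: w I + \sum_i 'X_i * (w I)^`M(i)].

Lemma sum_ext_contract1 w L : (\sum_i ext i (contract1 i w)) L = #|L|%:R *: w L.
Proof.
rewrite sum_ffunE (eq_bigr (fun i => if i \in L then w L else 0)).
  by rewrite -big_mkcond /= sumr_const scaler_nat.
move=> i _; rewrite wedge_dxE; case: ifP => // iL.
by rewrite contract1E !inE eqxx /= setD1K // sgn1K.
Qed.

Lemma mderivXU i j : ('X_j : S)^`M(i) = (i == j)%:R.
Proof.
rewrite mderivX mnm1E eq_sym; case: eqP => [->|_]; last by rewrite scale0r.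
suff -> : (U_(j) - U_(j))%MM = 0%MM by rewrite scale1r mpolyX0.
by apply/mnmP=> k; rewrite mnmBE subnn mnm0E.
Qed.

(** In [d i_R], differentiating the coefficient ['X_j] of the radial field leaves
    [\sum_i ext i (contract1 i w)], which counts the [dx_i]. The other terms pair with those of
    [i_R d] into Clifford relations, where only [i = j] remains and gives Euler's operator. *)
Lemma cartan w : extd (iR w) + iR (extd w) = euler w.
Proof.
have -> : extd (iR w) = \sum_i ext i (contract1 i w)
   + \sum_i \sum_j fmul 'X_j (ext i (contract1 j (pderiv i w))).
  rewrite -big_split; apply: eq_bigr => i _ /=.
  transitivity (\sum_j (fmul (i == j)%:R (ext i (contract1 j w)) +
      fmul 'X_j (ext i (contract1 j (pderiv i w))))).
    rewrite contractE !linear_sum; apply: eq_bigr => j _ /=.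
    by rewrite pderiv_fmul mderivXU linearD /= !ext_fmul pderiv_contract1.
  rewrite big_split /= (bigD1 i) //= eqxx fmul1 [X in _ + X + _]big1 ?addr0 //.
  move=> j; rewrite eq_sym => /negPf->.
  by apply/ffunP=> I; rewrite !ffunE mul0r.
have -> : iR (extd w) =
    \sum_i \sum_j fmul 'X_j (contract1 j (ext i (pderiv i w))).
  rewrite contractE exchange_big /=; apply: eq_bigr => j _.
  by rewrite /extd !linear_sum.
rewrite -addrA -big_split /=.
rewrite [X in _ + X](eq_bigr (fun i => fmul 'X_i (pderiv i w))).
  apply/ffunP=> L; rewrite ffunE sum_ext_contract1 ffunE sum_ffunE.
  by congr (_ + _); apply: eq_bigr => i _; rewrite !ffunE.
move=> i _; rewrite -big_split /= (bigD1 i) //= -linearD ext_contract1.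
rewrite eqxx scale1r big1 ?addr0 // => j ji.
by rewrite -linearD ext_contract1 eq_sym (negPf ji) scale0r linear0.
Qed.

End Operators.

(** * Operators acting on forms through the degree *)

Section Grading.
Variables (K : fieldType) (n : nat).
Local Notation S := {mpoly K[n]}.
Local Notation Omega := {ffun {set 'I_n} -> {mpoly K[n]}}.
Implicit Types (i j : 'I_n) (I J L : {set 'I_n}) (f g : S) (u v w : Omega).
Implicit Types (phi psi : nat -> K).

(** Multiplies the component of degree [k] by [phi k]. The Lie derivative, its partial inverse and
    the projections onto a degree all have this shape, so identities between them can be checked one
    coefficient at a time. *)
Definition mscale_deg phi f : S :=
  \sum_(m <- msupp f) (phi (mdeg m) * f@_m) *: 'X_[m].

Lemma mcoeff_mscale_deg phi f m :
  (mscale_deg phi f)@_m = phi (mdeg m) * f@_m.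
Proof.
rewrite {2}(mpolyE f) /mscale_deg !raddf_sum mulr_sumr; apply: eq_bigr => k _.
rewrite /= !mcoeffZ mcoeffX; have [->|_] := eqVneq k m; first by rewrite mulrA.
by rewrite !mulr0.
Qed.

Definition scale_deg phi w : Omega :=
  [ffun I : {set 'I_n} => mscale_deg (fun k => phi (#|I| + k)%N) (w I)].

Lemma mcoeff_scale_deg phi w I m :
  (scale_deg phi w I)@_m = phi (#|I| + mdeg m)%N * (w I)@_m.
Proof. by rewrite ffunE mcoeff_mscale_deg. Qed.

Lemma formP u v : (forall I m, (u I)@_m = (v I)@_m) -> u = v.
Proof. by move=> uv; apply/ffunP=> I; apply/mpolyP=> m. Qed.

Lemma scale_deg_is_linear phi : linear (scale_deg phi).
Proof.
move=> a u v; apply: formP => I m.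
rewrite mcoeff_scale_deg !formE !mcoeffD !mcoeffZ !mcoeff_scale_deg.
by rewrite mulrDr mulrCA.
Qed.
HB.instance Definition _ phi := GRing.isLinear.Build K Omega Omega _
  (scale_deg phi) (scale_deg_is_linear phi).

(** Euler's identity, monomial by monomial. *)
Lemma mscale_deg_natr f : mscale_deg (fun k => k%:R) f = \sum_i 'X_i * f^`M(i).
Proof.
rewrite [in RHS](mpolyE f).
under eq_bigr => i _ do rewrite linear_sum mulr_sumr.
rewrite exchange_big; apply: eq_bigr => m _ /=.
under eq_bigr => i _ do rewrite mderivZ mderivX.
rewrite mdegE natr_sum mulr_suml scaler_suml; apply: eq_bigr => i _.
rewrite -!scalerAr scalerA mulrC -mpolyXD.
(* If [m i = 0] the truncated subtraction [m - U_(i)] cannot be undone by adding [U_(i)], but then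
   the scalar [m i] vanishes. *)
have [->|mi] := eqVneq (m i) 0%N; first by rewrite mulr0 !scale0r.
congr (_ *: 'X_[_]); apply/mnmP=> k; rewrite mnmDE mnmBE mnm1E.
by case: eqP => [<-|_] //=; rewrite subnKC // lt0n.
Qed.

Definition lie_radial w : Omega := scale_deg (fun k => k%:R) w.
(** The convention [0^-1 = 0] makes this vanish in degree 0. *)
Definition deg_inv w : Omega := scale_deg (fun k => k%:R^-1) w.
Definition deg0_part w : Omega := scale_deg (fun k => (k == 0)%N%:R) w.

HB.instance Definition _ := GRing.isLinear.Build K Omega Omega _ lie_radial
  (scale_deg_is_linear _).
HB.instance Definition _ := GRing.isLinear.Build K Omega Omega _ deg_inv
  (scale_deg_is_linear _).
HB.instance Definition _ := GRing.isLinear.Build K Omega Omega _ deg0_part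
  (scale_deg_is_linear _).

Local Notation Lie := lie_radial.
Local Notation G := deg_inv.
Local Notation P := deg0_part.

Lemma mcoeff_lie_radial w I m :
  (Lie w I)@_m = (#|I| + mdeg m)%N%:R * (w I)@_m.
Proof. exact: mcoeff_scale_deg. Qed.

Lemma mcoeff_deg_inv w I m :
  (G w I)@_m = (#|I| + mdeg m)%N%:R^-1 * (w I)@_m.
Proof. exact: mcoeff_scale_deg. Qed.

Lemma mcoeff_deg0_part w I m :
  (P w I)@_m = ((#|I| + mdeg m)%N == 0)%:R * (w I)@_m.
Proof. exact: mcoeff_scale_deg. Qed.

Let mcoeff_opE :=
  (mcoeff_lie_radial, mcoeff_deg_inv, mcoeff_deg0_part, mcoeff_scale_deg).

Lemma eulerE w : euler w = Lie w.
Proof.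
apply: formP => I m; rewrite mcoeff_opE ffunE -mscale_deg_natr mcoeffD.
by rewrite mcoeffZ mcoeff_mscale_deg natrD mulrDl.
Qed.

Lemma Lie_fmul f w :
  Lie (fmul f w) = fmul (mscale_deg (fun k => k%:R) f) w + fmul f (Lie w).
Proof.
rewrite -!eulerE; apply/ffunP=> I; rewrite !ffunE mscale_deg_natr.
under eq_bigr => i _ do rewrite mderivM mulrDr.
rewrite big_split /= mulr_suml mulrDr -scalerAr mulr_sumr addrCA.
congr (_ + (_ + _)).
  by apply: eq_bigr => i _; rewrite mulrA.
by apply: eq_bigr => i _; rewrite mulrCA.
Qed.

Lemma pihomog_mscale_deg d f :
  pihomog mdeg d f = mscale_deg (fun k => (k == d)%:R) f.
Proof.
rewrite pihomogE big_mkcond; apply: eq_bigr => m _.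
by case: eqP => _; rewrite ?mul1r // mul0r scale0r.
Qed.

Lemma fcomp_scale_deg b w : fcomp b w = scale_deg (fun k => (k == b)%:R) w.
Proof.
apply: formP => I m; rewrite mcoeff_opE ffunE; case: leqP => Ib.
  rewrite pihomog_mscale_deg mcoeff_mscale_deg.
  by rewrite -(eqn_add2l #|I|) subnKC.
by rewrite mcoeff0 gtn_eqF ?mul0r // (leq_trans Ib) // leq_addr.
Qed.

(** Used with [k] the degree of a monomial and [x] its coefficient: the size bound [N] ensures that
    no component of the sum is cut off. *)
Lemma sum_delta (N k : nat) phi (x : K) : ((N <= k)%N -> x = 0) ->
  \sum_(c < N) phi c * ((k == c)%:R * x) = phi k * x.
Proof.
case: (ltnP k N) => [kN _|_ ->//]; last first.
  by rewrite big1 ?mulr0 // => i; rewrite !mulr0.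
rewrite (bigD1 (Ordinal kN)) //= eqxx mul1r big1 ?addr0 // => c ck.
by rewrite -[_ == _ :> nat]/(Ordinal kN == c) eq_sym (negPf ck) mul0r mulr0.
Qed.

Lemma sum_pihomog phi f :
  \sum_(c < msize f) phi c *: pihomog mdeg c f = mscale_deg phi f.
Proof.
apply/mpolyP=> m; rewrite raddf_sum mcoeff_mscale_deg.
under eq_bigr => c _ do rewrite /= mcoeffZ pihomog_mscale_deg mcoeff_mscale_deg.
by apply: sum_delta => /msize_mdeg_ge; rewrite -mcoeff_eq0 => /eqP.
Qed.

Lemma sum_fcomp phi w :
  \sum_(b < fsize w) phi b *: fcomp b w = scale_deg phi w.
Proof.
apply: formP => I m; rewrite sum_ffunE raddf_sum mcoeff_opE.
under eq_bigr => c _ do rewrite /= formE mcoeffZ fcomp_scale_deg mcoeff_opE.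
apply: sum_delta => szI; apply/eqP; rewrite mcoeff_eq0; apply: msize_mdeg_ge.
rewrite -(leq_add2l #|I|); apply: leq_trans _ szI.
by rewrite /fsize; apply: leq_bigmax.
Qed.

Lemma mscale_deg1 f : mscale_deg (fun=> 1) f = f.
Proof. by apply/mpolyP=> m; rewrite mcoeff_mscale_deg mul1r. Qed.

Lemma scale_deg1 w : scale_deg (fun=> 1) w = w.
Proof. by apply: formP=> I m; rewrite mcoeff_opE mul1r. Qed.

Lemma mscale_deg_eq0 f :
  mscale_deg (fun k => (k == 0)%N%:R) f = (f@_0%MM)%:MP.
Proof.
apply/mpolyP=> m; rewrite mcoeff_mscale_deg mcoeffC mdeg_eq0 mulrC.
by case: eqP => [->|]; rewrite ?mulr0.
Qed.

Lemma fmulC (a : K) w : fmul a%:MP w = a *: w.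
Proof. by apply/ffunP=> I; rewrite !ffunE mul_mpolyC. Qed.

(** Degree 0 forces the empty index set and the trivial monomial, so [f] enters only by its constant
    term. *)
Lemma P_fmul f w : P (fmul f w) = f@_0%MM *: P w.
Proof.
apply: formP => I m; rewrite formE mcoeffZ !mcoeff_opE ffunE mulrCA.
case: eqP => [/eqP|_]; last by rewrite !mul0r.
rewrite addn_eq0 mdeg_eq0 => /andP[_ /eqP->].
by rewrite !mul1r rmorphM.
Qed.

Lemma PP w : P (P w) = P w.
Proof.
apply: formP => I m; rewrite !mcoeff_opE.
by case: eqP => _; rewrite ?mul1r ?mul0r.
Qed.

Lemma P_fmulP f w : P (fmul f (P w)) = P (fmul f w).
Proof. by rewrite !P_fmul PP. Qed.

Lemma P_eq0 w : (w set0)@_0%MM = 0 -> P w = 0.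
Proof.
move=> w0; apply: formP => I m; rewrite mcoeff_opE ffunE mcoeff0.
case: eqP => [/eqP|_]; last by rewrite mul0r.
by rewrite addn_eq0 mdeg_eq0 cards_eq0 => /andP[/eqP-> /eqP->]; rewrite w0 mulr0.
Qed.

Hypothesis K0 : [pchar K] =i pred0.

Lemma natr_eq0 k : (k%:R == 0 :> K) = (k == 0)%N.
Proof. exact: (pcharf0P K).1. Qed.

(** Wherever [w] has a nonzero coefficient, the degree and [a] agree in [K], hence so do their
    inverses, the case [a = 0] included. *)
Lemma G_eigen w a : Lie w = a%:R *: w -> G w = a%:R^-1 *: w.
Proof.
move=> Lw; apply: formP => I m; have := congr1 (fun w => (w I)@_m) Lw.
rewrite !formE !mcoeffZ !mcoeff_opE.
have [->|w0] := eqVneq ((w I)@_m) 0; first by rewrite !mulr0.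
by move/(mulIf w0)->.
Qed.

Lemma LieG w : Lie (G w) = w - P w.
Proof.
apply: formP => I m; rewrite !formE mcoeffB !mcoeff_opE.
case: eqP => [->|/eqP k0]; first by rewrite mul0r mul1r subrr.
by rewrite mulVKf ?mul0r ?subr0 // natr_eq0.
Qed.

Lemma G_Lie_comm w : G (Lie w) = Lie (G w).
Proof. by apply: formP => I m; rewrite !mcoeff_opE mulrCA. Qed.

Lemma LieGLie w : Lie (G (Lie w)) = Lie w.
Proof.
apply: formP => I m; rewrite !mcoeff_opE; set k := (_ + _)%N.
have [->|k0] := eqVneq k 0%N; first by rewrite !mul0r.
by rewrite mulVKf // natr_eq0.
Qed.

Lemma GLieG w : G (Lie (G w)) = G w.
Proof.
apply: formP => I m; rewrite !mcoeff_opE; set k := (_ + _)%N.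
have [->|k0] := eqVneq k 0%N; first by rewrite invr0 !mul0r.
by rewrite mulKf // natr_eq0.
Qed.

Lemma PG w : P (G w) = 0.
Proof.
apply: P_eq0; rewrite mcoeff_opE cards0 mdeg0.
by rewrite invr0 mul0r.
Qed.

(* G is the group inverse of Lie, hence lies in its double commutant. *)
Lemma G_comm (F : Omega -> Omega) :
  (forall w, F (Lie w) = Lie (F w)) -> forall w, F (G w) = G (F w).
Proof.
move=> FL w.
have GGL v : G (G (Lie v)) = G v by rewrite [G (Lie v)]G_Lie_comm GLieG.
have LGG v : Lie (G (G v)) = G v by rewrite -G_Lie_comm GLieG.
have LLG v : Lie (Lie (G v)) = Lie v by rewrite -G_Lie_comm LieGLie.
transitivity (G (Lie (F (G w)))).
  by rewrite -{1}LGG FL -[LHS]LieGLie -FL LGG G_Lie_comm.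
by rewrite -[RHS]GGL -[Lie (F w)]FL -[Lie w]LLG !FL GGL.
Qed.

End Grading.

(** * Comparison of the given action with the homotopy action on forms *)

Section Action.
Variables (K : fieldType) (n : nat).
Hypothesis K0 : [pchar K] =i pred0.
Local Notation S := {mpoly K[n]}.
Local Notation Omega := {ffun {set 'I_n} -> {mpoly K[n]}}.
Implicit Types (i j : 'I_n) (I J L : {set 'I_n}) (f g : S) (u v w t : Omega).
Local Notation iR := (contract (@radial K n)).
Local Notation Lie := (@lie_radial K n).
Local Notation G := (@deg_inv K n).
Local Notation P := (@deg0_part K n).

Lemma magic_formula w : extd (iR w) + iR (extd w) = Lie w.
Proof. by rewrite cartan // eulerE. Qed.

Lemma extd_Lie w : extd (Lie w) = Lie (extd w).
Proof.
by rewrite -!magic_formula linearD /= extd_extd // add0r extd_extd //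
   linear0 addr0.
Qed.

Lemma contract_Lie w : iR (Lie w) = Lie (iR w).
Proof.
rewrite -!magic_formula linearD /= contract_contract // addr0.
by rewrite contract_contract // linear0 add0r.
Qed.

Lemma extd_G w : extd (G w) = G (extd w).
Proof. exact: (G_comm K0 extd_Lie). Qed.

Lemma contract_G w : iR (G w) = G (iR w).
Proof. exact: (G_comm K0 contract_Lie). Qed.

(** With [P] written through [Lie] and [G], its commutation with [d] and [i_R] follows from
    theirs. *)
Lemma P_def w : P w = w - Lie (G w).
Proof. by rewrite LieG // subKr. Qed.

Lemma extd_P w : extd (P w) = P (extd w).
Proof. by rewrite !P_def linearB /= extd_Lie extd_G. Qed.

Lemma contract_P w : iR (P w) = P (iR w).
Proof. by rewrite !P_def linearB /= contract_Lie contract_G. Qed.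

(** An exterior derivative has no component of form degree 0. *)
Lemma P_extd w : P (extd w) = 0.
Proof.
apply: P_eq0; rewrite sum_ffunE big1 ?mcoeff0 // => i _.
by rewrite wedge_dxE inE.
Qed.

(** The coefficients ['X_i] of the radial field have no constant term. *)
Lemma P_contract w : P (iR w) = 0.
Proof.
apply: P_eq0; rewrite ffunE raddf_sum big1 // => i _ /=.
rewrite rmorphM /= rmorphM /= /radial mcoeffX.
by rewrite -mdeg_eq0 mdeg1 mul0r mulr0.
Qed.

Definition form_act : S -> Omega -> Omega :=
  homotopy_act (fun f => fmul f : {additive Omega -> Omega})
    (@extd K n) iR G P.

Lemma Lie_fmul_homog c b f t :
  mscale_deg (fun k => k%:R) f = c%:R *: f -> Lie t = b%:R *: t ->
  Lie (fmul f t) = (b + c)%:R *: fmul f t.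
Proof.
by move=> hf ht; rewrite Lie_fmul hf ht fmulZl linearZ natrD scalerDl addrC.
Qed.

Lemma Lie_extd b t : Lie t = b%:R *: t -> Lie (extd t) = b%:R *: extd t.
Proof. by move=> ht; rewrite -extd_Lie ht linearZ. Qed.

Lemma Lie_contract b t : Lie t = b%:R *: t -> Lie (iR t) = b%:R *: iR t.
Proof. by move=> ht; rewrite -contract_Lie ht linearZ. Qed.

(** Homogeneity is stated as an eigenvalue condition. Then [u] has eigenvalue [b + c], so [G]
    divides it by [b + c], while the Leibniz rule and Cartan's formula turn [u] into
    [b f t + df /\ i_R t]. *)
Lemma dact_homog_form_act c b f t :
  mscale_deg (fun k => k%:R) f = c%:R *: f -> Lie t = b%:R *: t ->
  dact_homog c b f t =
    G (extd (fmul f (iR t)) + fmul f (iR (extd t)))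
    + fmul ((c == 0)%N%:R *: f) ((b == 0)%N%:R *: t).
Proof.
move=> hf ht; set u := _ + fmul f _.
have Lu : Lie u = (b + c)%:R *: u.
  rewrite [LHS]linearD [RHS]scalerDr; congr (_ + _).
    by apply/Lie_extd/Lie_fmul_homog/Lie_contract.
  by apply: Lie_fmul_homog => //; apply/Lie_contract/Lie_extd.
(* For [b = c = 0] the factor [0^-1 = 0] removes [u], and the last summand supplies [f t]; in all
   other cases that summand is zero. *)
rewrite (G_eigen Lu) /dact_homog; case: ifP => [/andP[/eqP-> /eqP->]|bc0].
  by rewrite !eqxx !scale1r invr0 scale0r add0r.
have -> : u = b%:R *: fmul f t + wedge (extd (form0 f)) (iR t).
  rewrite /u extd_fmul -addrA -linearD magic_formula ht.
  by rewrite linearZ addrC.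
move: bc0; case: eqP => //= _; last by rewrite scale0r linear0 addr0.
by move->; rewrite fmulZl scale0r addr0.
Qed.

Lemma fmul_suml (N : nat) (F : 'I_N -> S) w :
  fmul (\sum_(c < N) F c) w = \sum_(c < N) fmul (F c) w.
Proof.
apply/ffunP=> I; rewrite sum_ffunE ffunE mulr_suml.
by apply: eq_bigr => c _; rewrite ffunE.
Qed.

Lemma mscale_deg_pihomog d f :
  mscale_deg (fun k => k%:R) (pihomog mdeg d f) = d%:R *: pihomog mdeg d f.
Proof.
apply/mpolyP=> m; rewrite mcoeffZ mcoeff_mscale_deg pihomog_mscale_deg.
by rewrite mcoeff_mscale_deg; case: eqP => [->//|_]; rewrite mul0r !mulr0.
Qed.

Lemma Lie_fcomp b w : Lie (fcomp b w) = b%:R *: fcomp b w.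
Proof.
apply: formP => I m; rewrite formE mcoeffZ mcoeff_lie_radial fcomp_scale_deg.
by rewrite mcoeff_scale_deg; case: eqP => [->//|_]; rewrite mul0r !mulr0.
Qed.

(** Both sides are sums over homogeneous components of [f] and [t], on which [dact_homog_form_act]
    applies. *)
Lemma dact_form_act f t : dact f t = form_act f t.
Proof.
have sumf : \sum_(c < msize f) pihomog mdeg c f = f.
  rewrite -[RHS]mscale_deg1 -sum_pihomog.
  by apply: eq_bigr => c _; rewrite scale1r.
have sumt : \sum_(b < fsize t) fcomp b t = t.
  by rewrite -[RHS]scale_deg1 -sum_fcomp; apply: eq_bigr => c _; rewrite scale1r.
have sumf0 : \sum_(c < msize f) (c == 0 :> nat)%:R *: pihomog mdeg c f =
    (f@_0%MM)%:MP.
  by rewrite (sum_pihomog (fun k => (k == 0)%N%:R)) mscale_deg_eq0.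
rewrite /dact; transitivity (\sum_(c < msize f) \sum_(b < fsize t)
  (G (extd (fmul (pihomog mdeg c f) (iR (fcomp b t)))
      + fmul (pihomog mdeg c f) (iR (extd (fcomp b t))))
   + fmul ((c == 0 :> nat)%:R *: pihomog mdeg c f)
       ((b == 0 :> nat)%:R *: fcomp b t))).
  apply: eq_bigr => c _; apply: eq_bigr => b _.
  by apply: dact_homog_form_act; [apply: mscale_deg_pihomog | apply: Lie_fcomp].
have -> : form_act f t = \sum_(c < msize f)
    (G (extd (fmul (pihomog mdeg c f) (iR t)) +
        fmul (pihomog mdeg c f) (iR (extd t)))
     + fmul ((c == 0 :> nat)%:R *: pihomog mdeg c f) (P t)).
  (* The constant term of [f] is replaced by the sum [sumf0], so that the projection term also
     splits over the components of [f]. *)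
  rewrite /form_act /homotopy_act /= P_fmul -fmulC -sumf0 -{1 2}sumf.
  by rewrite !fmul_suml linear_sum -big_split linear_sum -big_split.
apply: eq_bigr => c _; rewrite big_split /=; congr (_ + _); last first.
  by rewrite -linear_sum (sum_fcomp (fun k => (k == 0)%N%:R)).
rewrite -linear_sum big_split -!linear_sum /=.
by rewrite sumt.
Qed.

Lemma form_act_module : is_module form_act.
Proof.
apply: homotopy_act_module => /=; first exact: fmulA.
- exact: fmul1.
- exact: fmulDl.
- exact: extd_extd.
- exact: contract_contract.
- exact: magic_formula.
- exact: contract_fmul.
- exact: extd_G.
- exact: contract_G.
- by move=> v; rewrite extd_P P_extd.
- by move=> v; rewrite contract_P P_contract.
- exact: P_contract.
- exact: P_extd.
- exact: PG.
- exact: PP.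
- by move=> v; rewrite G_Lie_comm LieG.
- exact: P_fmulP.
Qed.

Lemma extd_form_act f t : extd (form_act f t) = form_act f (extd t).
Proof.
apply: diff_homotopy_act => /=.
- exact: extd_extd.
- exact: extd_G.
- by move=> v; rewrite extd_P P_extd.
- exact: P_extd.
- exact: P_fmulP.
Qed.

(** * Stability of the forms of a fixed exterior degree *)

Lemma extd_rform r w : rform r w -> rform r.+1 (extd w).
Proof.
move=> hw I Ir; rewrite sum_ffunE big1 // => i _; rewrite wedge_dxE.
case: ifP => // iI; rewrite ffunE hw ?mderiv0 ?mulr0 //.
by apply: contraNneq Ir => <-; rewrite (cardsD1 i I) iI.
Qed.

Lemma contract_rform r w : rform r.+1 w -> rform r (iR w).
Proof.
move=> hw I Ir; rewrite ffunE big1 // => i iI.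
by rewrite hw ?mulr0 // cardsU1 iI.
Qed.

Lemma contract_rform0 w : rform 0 w -> iR w = 0.
Proof.
move=> hw; apply/ffunP=> I; rewrite !ffunE big1 // => i iI.
by rewrite hw ?mulr0 // cardsU1 iI.
Qed.

Lemma fmul_rform r f w : rform r w -> rform r (fmul f w).
Proof. by move=> hw I Ir; rewrite ffunE hw ?mulr0. Qed.

Lemma scale_deg_rform r phi w : rform r w -> rform r (scale_deg phi w).
Proof.
move=> hw I Ir; apply/mpolyP=> m; rewrite mcoeff_scale_deg hw //.
by rewrite mcoeff0 mulr0.
Qed.

Lemma rformD r u v : rform r u -> rform r v -> rform r (u + v).
Proof. by move=> hu hv I Ir; rewrite ffunE hu ?hv ?addr0. Qed.

Lemma form_act_rform r f t : rform r t -> rform r (form_act f t).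
Proof.
move=> ht; apply: rformD; last exact/scale_deg_rform/fmul_rform.
apply: scale_deg_rform; apply: rformD; last first.
  exact/fmul_rform/contract_rform/extd_rform.
(* In exterior degree 0 there is no lower degree for [i_R] to land in; there [i_R t = 0] removes the
   term. *)
case: r ht => [|r] ht; last exact/extd_rform/fmul_rform/contract_rform.
by rewrite /= contract_rform0 // !linear0 => I _; rewrite ffunE.
Qed.

(** * Finite generation *)

Definition dxset I : Omega := [ffun J => (J == I)%:R].

Lemma dxset_rform I : rform #|I| (dxset I).
Proof. by move=> J; rewrite ffunE; case: (eqVneq J I) => [->|//]; rewrite eqxx. Qed.

Lemma sum_dxset w : \sum_I fmul (w I) (dxset I) = w.
Proof.
apply/ffunP=> J; rewrite sum_ffunE (bigD1 J) //= !ffunE eqxx mulr1.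
rewrite big1 ?addr0 // => I IJ.
by rewrite !ffunE eq_sym (negPf IJ) mulr0.
Qed.

Lemma extd_dxset I : extd (dxset I) = 0.
Proof.
rewrite /extd big1 // => i _; rewrite -[RHS](linear0 (wedge (dx K i))).
congr wedge; apply/ffunP=> J; rewrite !ffunE.
by case: eqP => _; rewrite ?mderiv0 // -mpolyC1 mderivC.
Qed.

Lemma Lie_dxset I : Lie (dxset I) = #|I|%:R *: dxset I.
Proof.
rewrite -eulerE; apply/ffunP=> J; rewrite !ffunE big1 ?addr0.
  by case: eqP => [->//|_]; rewrite !scaler0.
by move=> i _; case: eqP => _; rewrite -?mpolyC1 ?mderivC ?mderiv0 mulr0.
Qed.

Lemma form_act_dxset f I :
  form_act f (dxset I) = G (extd (iR (fmul f (dxset I)))) + P (fmul f (dxset I)).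
Proof. exact/homotopy_act_closed/extd_dxset/contract_fmul. Qed.

Lemma form_act_contract_dxset f I :
  form_act f (iR (dxset I)) = G (iR (fmul (#|I|%:R *: f) (dxset I))).
Proof.
rewrite fmulZl -linearZ -Lie_dxset; apply: homotopy_act_contract_closed => /=.
- exact: contract_contract.
- exact: magic_formula.
- exact: contract_fmul.
- exact: P_contract.
- exact: extd_dxset.
Qed.

Lemma form_act_fin_generated r : fin_generated form_act (@rform K n r).
Proof.
(* Indexing by all subsets, with zero for irrelevant sizes, lets one family match the expansions of
   both [w] and [dw]. *)
pose gen I := if #|I| == r then dxset I else
              if #|I| == r.+1 then iR (dxset I) else 0.
pose T : finType := {set 'I_n}.
exists #|T|, (fun j : 'I_#|T| => gen (enum_val j)); split=> [j|w hw].
  rewrite /gen; case: eqP => [<-|_]; first exact: dxset_rform.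
  case: eqP => [eI|_]; last by move=> I _; rewrite ffunE.
  by apply: contract_rform; rewrite -eI; apply: dxset_rform.
(* The inverse of [#|I|] cancels the eigenvalue of [Lie] on [dxset I], which appears when a
   polynomial acts on [iR (dxset I)]. *)
pose a I := if #|I| == r then w I else (#|I|%:R^-1 : K) *: extd w I.
exists (fun j : 'I_#|T| => a (enum_val j)).
rewrite -(big_enum_val (A := T) (fun I => form_act (a I) (gen I))) /=.
have sumE (h : {linear Omega -> Omega}) v :
    h v = \sum_I h (fmul (v I) (dxset I)).
  by rewrite -linear_sum sum_dxset.
(* The homotopy decomposition of [w], with [w] and [extd w] expanded in the basis [dxset I] inside
   each linear operator. *)
have -> : w = \sum_I (G (extd (iR (fmul (w I) (dxset I))))
    + P (fmul (w I) (dxset I)) + G (iR (fmul (extd w I) (dxset I)))).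
  rewrite !big_split /= -(sumE (G \o @extd K n \o iR)) -(sumE P).
  rewrite -(sumE (G \o iR)) /=; apply: homotopy_decomp => v /=.
    exact: magic_formula.
  by rewrite G_Lie_comm LieG.
have fmul0 I : fmul 0 (dxset I) = 0.
  by apply/ffunP=> J; rewrite !ffunE mul0r.
apply: eq_big => [I|I _]; first by rewrite inE.
(* Sets of size [r] carry only coefficients of [w], those of size [r.+1] only coefficients of
   [extd w], and all others carry neither. *)
have dw := extd_rform hw; rewrite /a /gen; case: (eqVneq #|I| r) => [eI|nI].
  by rewrite dw ?eI ?ltn_eqF // fmul0 !linear0 addr0 form_act_dxset.
rewrite hw // fmul0 !linear0 add0r add0r; case: (eqVneq #|I| r.+1) => [eI|nI'].
  rewrite form_act_contract_dxset scalerA divff ?scale1r //.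
  by rewrite natr_eq0 // eI.
by rewrite dw // fmul0 !linear0 /form_act homotopy_act0.
Qed.

End Action.

Theorem proposition5p2 (R : realType) (n : nat) :
  let act := @dact R[i] n in
  [/\ is_module act,
      is_module_morphism act act (@extd R[i] n)
    & forall r : nat, is_submodule act (@rform R[i] n r) /\
                      fin_generated act (@rform R[i] n r)].
Proof.
move=> act; have R0 : [pchar R[i]] =i pred0 by exact: Num.Theory.pchar_num.
have actE f t : act f t = form_act f t by exact: dact_form_act.
have [actA act1 actDr actDl] := form_act_module n R0.
split.
- by split=> *; rewrite !actE.
- by split=> [u v|f v]; [exact: linearD | rewrite !actE; exact: extd_form_act].
- move=> r; split.
    split=> [I _|u v|f v]; first by rewrite ffunE.
      exact: rformD.
    by rewrite actE; apply: form_act_rform.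
  have [m [g [gr gen]]] := form_act_fin_generated n R0 r.
  exists m, g; split=> // v /gen[a ->]; exists a.
  by apply: eq_bigr => j _; rewrite actE.
Qed.
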